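(* Let $k\ge 1$ be an integer and $a>0$ a real number. Let $\lambda$ be a random variable with the gamma distribution $G(1/k,a)$, i.e. with density $$f(\lambda)=\frac{a^{1/k}}{\Gamma(1/k)}e^{-a\lambda}\lambda^{(1/k)-1},\qquad \lambda>0,$$ and let $\{X(t),t\ge0\}$ be a process which, conditionally on $\lambda$, is a Poisson process with rate $\lambda$. Put $Z(t)=kX(t)+1$. Then the mean and the variance of $Z(t)$ depend on $t$ (they are non-constant functions of $t$), the distribution of $Z(t)$ depends on $t$, and the process $\{Z(t),t\ge0\}$ is not stationary.
   Context: Conditionally on $\lambda$, $P(X(t)=n\mid\lambda)=e^{-\lambda t}(\lambda t)^n/n!$ for $n=0,1,2,\ldots$ A process is stationary if its finite-dimensional distributions are invariant under time shifts. *)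

(* Defs.v *)
From HB Require Import structures.
From mathcomp Require Import all_boot all_order all_algebra.
From mathcomp Require Import all_classical all_reals all_analysis.

Set Implicit Arguments.
Unset Strict Implicit.
Unset Printing Implicit Defensive.

Import Order.TTheory GRing.Theory Num.Theory.
Import numFieldNormedType.Exports.

Local Open Scope classical_set_scope.
Local Open Scope ring_scope.

Definition Gamma (R : realType) (s : R) : R :=
  \int[lebesgue_measure]_(x in `]0, +oo[) (x `^ (s - 1) * expR (- x)).

(* [s] is the shape and [a] the rate. *)
Definition gamma_pdf (R : realType) (s a x : R) : R :=
  if 0 < x then a `^ s / Gamma s * expR (- (a * x)) * x `^ (s - 1) else 0.

Definition gamma_distributed (R : realType) (d : measure_display)
    (T : measurableType d) (P : probability T R) (s a : R)
    (Y : {RV P >-> R}) : Prop :=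
  forall A : set R, measurable A ->
    distribution P Y A = (\int[lebesgue_measure]_(x in A) (gamma_pdf s a x)%:E)%E.

(* [q] is a version of y |-> P(E | Y = y), i.e. [q \o Y] is a version of the
   conditional probability of [E] given the sigma-algebra generated by [Y]. *)
Definition is_cond_prob (R : realType) (d : measure_display)
    (T : measurableType d) (P : probability T R) (Y : {RV P >-> R})
    (E : set T) (q : R -> R) : Prop :=
  measurable_fun [set: R] q /\
  forall B : set R, measurable B ->
    P (E `&` Y @^-1` B) = (\int[P]_(w in Y @^-1` B) (q (Y w))%:E)%E.

(* Conditionally on [lam], [X] starts at 0 and its increments over successive
   intervals [t i, t i.+1] are independent and Poisson distributed with
   parameters [lam * (t i.+1 - t i)]. Case [m = 0] says that [X 0 = 0] almost
   surely. [X] is only constrained at nonnegative times. The times are strictly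
   increasing because [poisson_pmf] has a dummy value at parameters <= 0; since
   its argument is then positive where [l > 0], only [l <= 0] sees that value. *)
Definition cond_poisson_process (R : realType) (d : measure_display)
    (T : measurableType d) (P : probability T R) (lam : {RV P >-> R})
    (X : R -> {RV P >-> nat}) : Prop :=
  forall (m : nat) (t : nat -> R) (n : nat -> nat),
    t 0%N = 0 -> (forall i, t i < t i.+1) ->
    is_cond_prob lam
      [set w | X 0 w = 0%N /\
               forall i, (i < m)%N -> X (t i.+1) w = (X (t i) w + n i)%N]
      (fun l => \prod_(i < m) poisson_pmf (l * (t i.+1 - t i)) (n i)).

Section affine_count.
Context (R : realType) (d : measure_display) (T : measurableType d).

Definition affine_count (k : nat) (X : {mfun T >-> nat}) : T -> R :=
  fun w => k%:R * (X w)%:R + 1.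

Variables (k : nat) (X : {mfun T >-> nat}).

Let measurable_affine_count : measurable_fun [set: T] (affine_count k X).
Proof.
apply: (@measurableT_comp _ _ _ _ _ _ (fun n : nat => k%:R * n%:R + 1 : R)) => //.
Qed.

HB.instance Definition _ :=
  isMeasurableFun.Build _ _ _ _ (affine_count k X) measurable_affine_count.

End affine_count.

Definition Zproc (R : realType) (d : measure_display) (T : measurableType d)
    (P : probability T R) (k : nat) (X : R -> {RV P >-> nat}) (t : R) :
    {RV P >-> R} :=
  affine_count R k (X t).

(* Joint law of (Y (t_0), ..., Y (t_(m-1))) on the product sigma-algebra. *)
Definition fin_dim_distribution (R : realType) (d : measure_display)
    (T : measurableType d) (P : probability T R) (Y : R -> {RV P >-> R})
    (m : nat) (t : m.-tuple R) : set (m.-tuple R) -> \bar R :=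
  pushforward P (fun w => [tuple Y (tnth t i) w | i < m]).

Definition stationary (R : realType) (d : measure_display)
    (T : measurableType d) (P : probability T R) (Y : R -> {RV P >-> R}) :
    Prop :=
  forall (m : nat) (t : m.-tuple R) (h : R),
    (forall i, 0 <= tnth t i) -> 0 <= h ->
    forall A : set (m.-tuple R), measurable A ->
      fin_dim_distribution Y [tuple tnth t i + h | i < m] A =
      fin_dim_distribution Y t A.

(* Main.v *)
Require Import Defs.
From HB Require Import structures.
From mathcomp Require Import all_boot all_order all_algebra.
From mathcomp Require Import all_classical all_reals all_analysis.
From mathcomp Require Import measurable_realfun ring.

Set Implicit Arguments.
Unset Strict Implicit.
Unset Printing Implicit Defensive.

Import Order.TTheory GRing.Theory Num.Theory.
Import numFieldNormedType.Exports.

Local Open Scope classical_set_scope.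
Local Open Scope ring_scope.

(** Given [lam], the count [X t] is Poisson with parameter [lam * t], so its
randomness really depends on [t]: at time [0] it vanishes almost surely, whereas
at a time [t > 0] every value [n] has positive probability, namely the
expectation of [poisson_pmf (lam * t) n], a positive function
([cond_poisson_marginal_gt0]). Hence [Z 0] is almost surely the constant [1],
and [Z t] is almost surely equal to no constant when [t > 0]
([Zproc_not_ae_cst]). Everything that distinguishes the two times follows from
this contrast. As [Z t >= 1], equality of the means would force [Z t = 1] almost
surely; equality of the variances would force a zero variance; equality of the
laws on [set 1] would force [Z t = 1] again; and stationarity implies equality
of the laws.

The gamma law enters only through the finiteness of the moments. Its exponential
moment of order [a / 2] is finite ([integral_expR_gamma_lty]). The probability
generating function of the Poisson law turns an exponential moment of [lam] into
one of [X t] ([cond_poisson_expR_moment]): it identifies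
[E (exp (c * X t))] with [E (exp (t * (exp c - 1) * lam))], and [c > 0] can be
chosen with [t * (exp c - 1) = a / 2]. So [X t], and with it [Z t], is square
integrable, and its mean and variance are finite. *)

(** * Integration against a measure with a density *)

Section densities.
Local Open Scope ereal_scope.
Context d (T : measurableType d) (R : realType).
Variables (nu : {finite_measure set T -> \bar R})
          (mu : {sigma_finite_measure set T -> \bar R}) (h : T -> R).
Hypothesis mh : measurable_fun [set: T] h.
Hypothesis nuE :
  forall A, measurable A -> nu A = \int[mu]_(x in A) (h x)%:E.

(** By uniqueness of the Radon-Nikodym derivative, [h] is almost everywhere the
derivative of [nu] with respect to [mu]. *)
Lemma ge0_integral_density (f : T -> \bar R) :
  measurable_fun [set: T] f -> (forall x, 0 <= f x) ->
  \int[nu]_x f x = \int[mu]_x (f x * (h x)%:E).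
Proof.
move=> mf f0.
have mEh : measurable_fun [set: T] (EFin \o h) by exact/measurable_EFinP.
have numu : nu `<< mu.
  apply/null_content_dominatesP => A mA muA0.
  rewrite nuE//; apply: null_set_integral => //.
  exact: measurable_funTS.
have igf := Radon_Nikodym_SigmaFinite.f_integrable numu.
rewrite -(Radon_Nikodym_SigmaFinite.change_of_variables numu)//.
apply: ae_eq_integral => //.
- by apply: emeasurable_funM => //; exact: measurable_int igf.
- exact: emeasurable_funM.
- apply: ae_eqe_mul2l; apply: integral_ae_eq => // E _ mE.
  by rewrite -nuE// -Radon_Nikodym_SigmaFinite.f_integral.
Qed.

End densities.

(** * The gamma distribution *)

Section gamma_distribution.
Context (R : realType) (s a : R).
Hypotheses (s_le1 : s <= 1) (a_gt0 : 0 < a).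

Lemma Gamma_ge0 : 0 <= Gamma s.
Proof.
by apply: Rintegral_ge0 => x _; rewrite mulr_ge0 ?powR_ge0 ?expR_ge0.
Qed.

Lemma gamma_pdf_ge0 x : 0 <= gamma_pdf s a x.
Proof.
rewrite /gamma_pdf; case: ifPn => // x0.
by rewrite !mulr_ge0 ?invr_ge0 ?Gamma_ge0 ?powR_ge0 ?expR_ge0.
Qed.

Lemma measurable_gamma_pdf : measurable_fun [set: R] (gamma_pdf s a).
Proof.
apply: measurable_fun_if => //; first exact: measurable_fun_ltr.
apply: measurable_funM; last exact: measurable_funTS.
apply: measurable_funM => //.
apply: measurable_funTS; apply: measurableT_comp => //.
by apply: measurableT_comp => //; exact: measurable_funM.
Qed.

(** The right-hand side is integrable without any knowledge of the Gamma function.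
For [x <= 1] the exponential factor is at most [expR (a / 2)]. For [x > 1] the
power [x `^ (s - 1)] is at most [1], because [s <= 1], and what remains is a
multiple of the exponential density of rate [a / 2]. *)
Lemma expR_gamma_pdf_le x :
  expR (a / 2 * x) * gamma_pdf s a x <=
  expR (a / 2) * gamma_pdf s a x +
  a `^ s / Gamma s * (2 / a) * exponential_pdf (a / 2) x.
Proof.
have C0 : 0 <= a `^ s / Gamma s by rewrite divr_ge0 ?powR_ge0 ?Gamma_ge0.
have a20 : 0 <= 2 / a by rewrite divr_ge0 ?ltW.
have [x1|x1] := leP x 1.
  rewrite (@le_trans _ _ (expR (a / 2) * gamma_pdf s a x))//.
    by rewrite ler_wpM2r ?gamma_pdf_ge0// ler_expR ler_piMr// divr_ge0// ltW.
  rewrite lerDl; apply: mulr_ge0; first exact: mulr_ge0.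
  by rewrite exponential_pdf_ge0// divr_ge0// ltW.
apply: ler_wpDl; first by rewrite mulr_ge0 ?expR_ge0 ?gamma_pdf_ge0.
have x0 : 0 < x by rewrite (lt_trans _ x1).
rewrite /gamma_pdf x0 exponential_pdfE ?(ltW x0)//.
rewrite [leRHS](_ : _ = a `^ s / Gamma s * expR (- (a / 2) * x)); last first.
  by move: (Gamma s)^-1 (expR _) => u v; field; rewrite gt_eqF.
rewrite [leLHS](_ : _ = a `^ s / Gamma s *
  (expR (a / 2 * x) * expR (- (a * x))) * x `^ (s - 1)); last by ring.
rewrite -expRD (_ : a / 2 * x + _ = - (a / 2) * x); last by field.
rewrite ler_piMr// ?mulr_ge0 ?expR_ge0 ?powR_ge0 ?invr_ge0 ?Gamma_ge0//.
rewrite -[leRHS](powRr0 x) ler_powR ?subr_le0//; exact: ltW.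
Qed.

Context d (T : measurableType d) (P : probability T R) (Y : {RV P >-> R}).
Hypothesis Y_gamma : gamma_distributed s a Y.

(** Lebesgue measure lives on the Borel structure [measurableTypeR R], whose
display differs from the one carried by [R] as codomain of [Y]; the law of [Yb]
is the law of [Y] seen on the former. *)
Let Yb : T -> measurableTypeR R := Y.

Let measurable_Yb : measurable_fun [set: T] Yb.
Proof. by move=> mT B mB; apply: (@measurable_funPT _ _ _ _ Y mT B). Qed.

#[local] HB.instance Definition _ :=
  isMeasurableFun.Build _ _ _ _ Yb measurable_Yb.

(** The gamma density has integral [1] because it is the density of a probability,
so [expR_gamma_pdf_le] bounds the integral by the sum of two finite terms. *)
Lemma integral_expR_gamma_lty :
  (\int[P]_w (expR (a / 2 * Y w))%:E < +oo)%E.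
Proof.
have mg := measurable_gamma_pdf.
have pdf1 : (\int[lebesgue_measure]_x (gamma_pdf s a x)%:E = 1)%E.
  by rewrite -Y_gamma// probability_setT.
have me : measurable_fun [set: R] (fun x => (expR (a / 2 * x))%:E).
  apply/measurable_EFinP; apply: (measurableT_comp (@measurable_expR R)).
  exact: measurable_funM.
have := @ge0_integral_distribution _ _ _ _ _ P
  Yb (fun x => (expR (a / 2 * x))%:E) me (fun x => expR_ge0 _).
rewrite /comp => <-.
rewrite (@ge0_integral_density _ (measurableTypeR R) R (distribution P Yb)
  (@lebesgue_measure R) _ mg Y_gamma)//.
have a20 : 0 <= a / 2 by rewrite divr_ge0// ltW.
pose g x : \bar R := ((expR (a / 2))%:E * (gamma_pdf s a x)%:E +
  (a `^ s / Gamma s * (2 / a))%:E * (exponential_pdf (a / 2) x)%:E)%E.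
have C0 : 0 <= a `^ s / Gamma s * (2 / a).
  by rewrite !mulr_ge0 ?invr_ge0 ?powR_ge0 ?Gamma_ge0// ltW.
have mEg : measurable_fun [set: R] (EFin \o gamma_pdf s a).
  exact/measurable_EFinP.
have mEe : measurable_fun [set: R] (EFin \o exponential_pdf (a / 2)).
  by apply/measurable_EFinP; exact: measurable_exponential_pdf.
apply: (@le_lt_trans _ _ (\int[lebesgue_measure]_x g x)%E).
  apply: ge0_le_integral => //.
  - by move=> x _; rewrite mule_ge0// lee_fin ?expR_ge0 ?gamma_pdf_ge0.
  - exact: emeasurable_funM.
  - by apply: emeasurable_funD; exact: emeasurable_funM.
  - by move=> x _; rewrite /g -!EFinM -EFinD lee_fin expR_gamma_pdf_le.
rewrite ge0_integralD//; first last.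
- exact: emeasurable_funM.
- by move=> x _; rewrite mule_ge0// lee_fin exponential_pdf_ge0.
- exact: emeasurable_funM.
- by move=> x _; rewrite mule_ge0// lee_fin ?expR_ge0 ?gamma_pdf_ge0.
rewrite !ge0_integralZl_EFin ?expR_ge0//; first last.
- by move=> x _; rewrite lee_fin gamma_pdf_ge0.
- by move=> x _; rewrite lee_fin exponential_pdf_ge0.
rewrite pdf1 integral_exponential_pdf ?divr_gt0//.
by rewrite !mule1 -EFinD ltry.
Qed.

Lemma gamma_ae_gt0 : {ae P, forall w, 0 < Y w}.
Proof.
exists (Y @^-1` `]-oo, 0]); split.
- exact: measurable_funPTI.
- rewrite -[LHS]/(distribution P Y `]-oo, 0]) Y_gamma//.
  apply: integral0_eq => x /=; rewrite in_itv/= => x0.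
  by rewrite /gamma_pdf ltNge x0.
- by move=> w /= /negP; rewrite -leNgt in_itv.
Qed.

End gamma_distribution.

(** * Random variables and their moments *)

Section random_variables.
Local Open Scope ereal_scope.
Context d (T : measurableType d) (R : realType) (P : probability T R).

Lemma ge0_expectation_nat (N : {RV P >-> nat}) (f : nat -> R) :
  (forall n, 0 <= f n)%R ->
  \int[P]_w (f (N w))%:E = \sum_(n <oo) (f n)%:E * P (N @^-1` [set n]).
Proof.
move=> f0; pose F n := N @^-1` [set n].
have mF n : measurable (F n) by exact: measurable_funPTI.
have FT : \bigcup_n F n = setT by apply/seteqP; split => // w _; exists (N w).
rewrite -FT ge0_integral_bigcup//.
- apply: eq_eseriesr => n _; rewrite -integral_cst; last exact: mF.
  by apply: eq_integral => w; rewrite inE => <-.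
- rewrite FT; apply/measurable_EFinP.
  by apply: (@measurableT_comp _ _ _ _ _ _ f).
- by move=> w _; rewrite lee_fin.
- by apply: trivIset_preimage1.
Qed.

Lemma ae_eq_expectation (X Y : T -> R) :
  measurable_fun setT X -> measurable_fun setT Y ->
  {ae P, forall w, X w = Y w} -> 'E_P[X] = 'E_P[Y].
Proof.
move=> mX mY XY; rewrite unlock; apply: ae_eq_integral => //.
- exact/measurable_EFinP.
- exact/measurable_EFinP.
- by apply: filterS XY => w /= ->.
Qed.

Lemma expectation_ge0_eq0 (X : T -> R) : measurable_fun setT X ->
  (forall w, 0 <= X w)%R -> 'E_P[X] = 0 -> {ae P, forall w, X w = 0%R}.
Proof.
move=> mX X0; rewrite unlock => EX0.
have mEX : measurable_fun setT (EFin \o X) by exact/measurable_EFinP.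
have : \int[P]_w `|(EFin \o X) w| = 0.
  by rewrite -[RHS]EX0; apply: eq_integral => w _; rewrite gee0_abs ?lee_fin.
move/(ae_eq_integral_abs P measurableT mEX).
by apply: filterS => w /= /(_ I) [].
Qed.

Lemma variance_eq0 (X : T -> R) : measurable_fun setT X -> 'V_P[X] = 0 ->
  {ae P, forall w, X w = fine 'E_P[X]}.
Proof.
set m := fine 'E_P[X] => mX VX0.
have mD : measurable_fun setT (fun w => (X w - m) ^+ 2)%R.
  by apply: measurable_funX; exact: measurable_funB.
have D0 : 'E_P[(fun w => (X w - m) ^+ 2)%R] = 0.
  by rewrite -[RHS]VX0 /variance covariance.unlock.
apply: filterS (expectation_ge0_eq0 mD (fun w => sqr_ge0 _) D0) => w /= /eqP.
by rewrite sqrf_eq0 subr_eq0 => /eqP.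
Qed.

Lemma Lfun2P (X : T -> R) : measurable_fun setT X ->
  \int[P]_w (X w ^+ 2)%:E < +oo -> X \in Lfun P 2%:E.
Proof.
move=> mX X2; rewrite inE/=; apply/andP; split; first by rewrite inE.
rewrite inE/= /finite_norm unlock.
rewrite poweR_lty//; apply: le_lt_trans X2.
rewrite le_eqVlt; apply/orP; left; apply/eqP; apply: eq_integral => w _ /=.
by rewrite powR_mulrn// real_normK// num_real.
Qed.

(** Since [(c * x) ^+ 2 / 2 <= expR (c * x)] for [x >= 0], an exponential moment of
any positive order dominates the second moment. *)
Lemma sqr_integrable_of_exp_moment (X : T -> R) (c : R) :
  measurable_fun setT X -> (0 < c)%R -> (forall w, 0 <= X w)%R ->
  \int[P]_w (expR (c * X w))%:E < +oo ->
  X \in Lfun P 2%:E.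
Proof.
move=> mX c0 X0 ecX; apply: Lfun2P => //.
pose K : R := (2 / c ^+ 2)%R.
have K0 : (0 <= K)%R by rewrite divr_ge0// exprn_ge0// ltW.
have me : measurable_fun setT (fun w => expR (c * X w)).
  by apply: measurableT_comp => //; exact: measurable_funM.
apply: (@le_lt_trans _ _ (\int[P]_w (K%:E * (expR (c * X w))%:E))).
  apply: ge0_le_integral => //.
  - by move=> w _; rewrite lee_fin sqr_ge0.
  - by apply/measurable_EFinP; exact: measurable_funX.
  - by apply: emeasurable_funM => //; exact/measurable_EFinP.
  - move=> w _; rewrite -EFinM lee_fin.
    have cX0 : (0 <= c * X w)%R by rewrite mulr_ge0// ltW.
    rewrite -[leLHS](_ : K * ((c * X w) ^+ 2 / 2) = _)%R; last first.
      by rewrite /K; field; rewrite gt_eqF.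
    rewrite ler_wpM2l// (le_trans _ (expR_ge1Dxn 1 cX0))//.
    by rewrite [leRHS]addrC lerDl.
rewrite ge0_integralZl_EFin//.
- by rewrite lte_mul_pinfty// lee_fin.
- exact/measurable_EFinP.
Qed.

Lemma ae_gt0_witness (Q : T -> Prop) (B : set T) :
  {ae P, forall w, Q w} -> measurable B -> 0 < P B -> exists2 w, B w & Q w.
Proof.
move=> aeQ mB; rewrite lt0e => /andP[PB _]; apply: contrapT => nBQ.
move/eqP: PB; apply; apply: measure_negligible => //.
by apply: negligibleS aeQ => w Bw Qw; apply: nBQ; exists w.
Qed.

End random_variables.

(** * The generating function of the Poisson distribution *)

Section poisson.
Local Open Scope ereal_scope.
Context (R : realType).

(** Tilting the Poisson mass of parameter [l] by [expR (c * n%:R)] gives, up to the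
factor on the right-hand side, the Poisson mass of parameter [l * expR c], whose
total is [1]. *)
Lemma expR_moment_poisson (l c : R) : (0 < l)%R ->
  \sum_(n <oo) (expR (c * n%:R))%:E * (poisson_pmf l n)%:E =
  (expR (l * (expR c - 1)))%:E.
Proof.
move=> l0; have lc0 : (0 < l * expR c)%R by rewrite mulr_gt0// expR_gt0.
transitivity (\sum_(n <oo) (expR (l * (expR c - 1)))%:E *
    (poisson_pmf (l * expR c) n)%:E).
  apply: eq_eseriesr => n _; rewrite -!EFinM /poisson_pmf l0 lc0; congr EFin.
  have -> : expR (c * n%:R) = (expR c ^+ n)%R by rewrite mulrC expRM_natl.
  rewrite mulrBr mulr1 expRD exprMn expRN [in RHS]expRN.
  by field; rewrite !gt_eqF ?expR_gt0// ltr0n fact_gt0.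
rewrite nneseriesZl; last by move=> n _; rewrite lee_fin poisson_pmf_ge0.
have := probability_setT (poisson_prob (l * expR c)%R 0%N).
rewrite /= /poisson_prob lc0 -nneseries_esumT; last first.
  by move=> n; rewrite lee_fin poisson_pmf_ge0.
by move=> ->; rewrite mule1.
Qed.

End poisson.

(** * One-dimensional marginals of a conditional Poisson process *)

Section conditional_poisson_process.
Local Open Scope ereal_scope.
Context (R : realType) d (T : measurableType d) (P : probability T R).
Variables (lam : {RV P >-> R}) (X : R -> {RV P >-> nat}).
Hypothesis X_poisson : cond_poisson_process lam X.
Hypothesis lam_gt0 : {ae P, forall w, 0 < lam w}%R.

Lemma cond_poisson_at0 : {ae P, forall w, X 0%R w = 0%N}.
Proof.
have [||_ ] := @X_poisson 0%N (fun i => i%:R) (fun=> 0%N).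
- by [].
- by move=> i; rewrite ltr_nat.
move=> /(_ _ measurableT); rewrite preimage_setT setIT.
rewrite [X in _ = X -> _](_ : _ = 1); last first.
  under eq_integral do rewrite big_ord0.
  by rewrite integral_cst// mul1e; exact: probability_setT.
have -> : [set w | X 0%R w = 0%N /\ (forall i, (i < 0)%N ->
    X (i.+1%:R) w = (X i%:R w + 0)%N)] = X 0%R @^-1` [set 0%N].
  by apply/seteqP; split => [w []//|w ?]; split.
move=> PX0.
have mX0 : measurable (X 0%R @^-1` [set 0%N]) by exact: measurable_funPTI.
exists (~` (X 0%R @^-1` [set 0%N])); split => //.
- exact: measurableC.
- by rewrite probability_setC// PX0 subee.
Qed.

(** This is the case of one increment, over the interval from [0] to [t]; the event
[X 0 = 0] that comes with it is almost sure by [cond_poisson_at0]. *)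
Lemma cond_poisson_marginal (t : R) (n : nat) : (0 < t)%R ->
  P (X t @^-1` [set n]) = \int[P]_w (poisson_pmf (lam w * t) n)%:E.
Proof.
move=> t0.
have [||_ ] := @X_poisson 1%N (fun i => i%:R * t)%R (fun=> n).
- by rewrite mul0r.
- by move=> i; rewrite ltr_pM2r// ltr_nat.
move=> /(_ _ measurableT); rewrite preimage_setT setIT.
under eq_integral do rewrite big_ord1 mul1r mul0r subr0.
move=> <-.
have mX s m : measurable (X s @^-1` [set m]) by exact: measurable_funPTI.
have -> : [set w | X 0%R w = 0%N /\ (forall i, (i < 1)%N ->
    X (i.+1%:R * t)%R w = (X (i%:R * t)%R w + n)%N)] =
    X t @^-1` [set n] `&` X 0%R @^-1` [set 0%N].
  apply/seteqP; split => [w [X0 /(_ 0%N isT)]|w [/= Xt X0]].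
    by rewrite mul1r mul0r X0.
  by split => // -[|//] _; rewrite mul1r mul0r X0.
rewrite (measureDI P (mX t n) (mX 0%R 0%N)) -[RHS]add0e; congr (_ + _).
apply: (measure_negligible (measurableD (mX _ _) (mX _ _))).
by apply: negligibleS cond_poisson_at0 => w [].
Qed.

Lemma measurable_cond_poisson_pmf (t : R) (n : nat) :
  measurable_fun setT (fun w => poisson_pmf (lam w * t) n).
Proof.
apply: (@measurableT_comp _ _ _ _ _ _ (fun l : R => poisson_pmf l n)).
  exact: measurable_poisson_pmf.
exact: measurable_funM.
Qed.

Lemma measurable_natr_RV (t : R) :
  measurable_fun setT (fun w => (X t w)%:R : R).
Proof. by apply: (@measurableT_comp _ _ _ _ _ _ (fun n : nat => n%:R : R)). Qed.

(** Both sides equal the sum over [n] of the expectations of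
[expR (c * n%:R) * poisson_pmf (lam * t) n]: on the left by splitting along the
values of [X t], on the right by exchanging sum and integral. Almost sure
positivity of [lam] keeps [poisson_pmf] away from its dummy value. *)
Lemma cond_poisson_expR_moment (t c : R) : (0 < t)%R ->
  \int[P]_w (expR (c * (X t w)%:R))%:E =
  \int[P]_w (expR (t * (expR c - 1) * lam w))%:E.
Proof.
move=> t0; pose f n w := (expR (c * n%:R))%:E * (poisson_pmf (lam w * t) n)%:E.
have mpmf n := measurable_cond_poisson_pmf t n.
have mf n : measurable_fun setT (f n).
  by apply: emeasurable_funM => //; exact/measurable_EFinP.
have f0 n w : 0 <= f n w.
  by rewrite mule_ge0// lee_fin ?expR_ge0 ?poisson_pmf_ge0.
rewrite (ge0_expectation_nat (X t) (fun n => expR_ge0 (c * n%:R))).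
transitivity (\sum_(n <oo) \int[P]_w f n w).
  apply: eq_eseriesr => n _; rewrite cond_poisson_marginal//.
  rewrite ge0_integralZl_EFin ?expR_ge0//.
  - by move=> w _; rewrite lee_fin poisson_pmf_ge0.
  - exact/measurable_EFinP.
rewrite -integral_nneseries//; apply: ae_eq_integral => //.
- exact: ge0_emeasurable_sum.
- apply/measurable_EFinP; apply: (measurableT_comp (@measurable_expR R)).
  exact: measurable_funM.
- apply: filterS lam_gt0 => w lamw0 _.
  rewrite expR_moment_poisson ?mulr_gt0//; congr (expR _)%:E; ring.
Qed.

(** A nonnegative function with zero expectation vanishes almost surely, whereas
[poisson_pmf] is positive everywhere, at its dummy value too. *)
Lemma cond_poisson_marginal_gt0 (t : R) (n : nat) : (0 < t)%R ->
  0 < P (X t @^-1` [set n]).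
Proof.
move=> t0; rewrite lt0e measure_ge0 andbT; apply/eqP.
rewrite cond_poisson_marginal// => E0.
have : 'E_P[(fun w => poisson_pmf (lam w * t) n)] = 0 by rewrite unlock.
move/(expectation_ge0_eq0 (measurable_cond_poisson_pmf _ _)
  (fun w => poisson_pmf_ge0 _ _)) => ae0.
have [|w _] := ae_gt0_witness ae0 measurableT.
  by rewrite probability_setT.
rewrite /poisson_pmf; case: ifPn => [l0|_] /eqP; last by rewrite oner_eq0.
by rewrite gt_eqF// !mulr_gt0 ?exprn_gt0 ?invr_gt0 ?ltr0n ?fact_gt0 ?expR_gt0.
Qed.

Lemma cond_poisson_Lfun2 (b t : R) : (0 < b)%R -> (0 <= t)%R ->
  \int[P]_w (expR (b * lam w))%:E < +oo ->
  (fun w => (X t w)%:R : R) \in Lfun P 2%:E.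
Proof.
move=> b0; rewrite le_eqVlt => /predU1P[<- _|t0 elam].
  apply: Lfun2P; first exact: measurable_natr_RV.
  rewrite (ae_eq_integral (cst 0)) ?integral0//.
  - apply/measurable_EFinP; apply: measurable_funX.
    exact: measurable_natr_RV.
  - by apply: filterS cond_poisson_at0 => w -> _; rewrite expr0n.
(* The exponent [ln (1 + b / t)] is the [c] that solves [t * (expR c - 1) = b]. *)
have bt0 : (0 < b / t)%R by rewrite divr_gt0.
apply: (@sqr_integrable_of_exp_moment _ _ _ _ _ (ln (1 + b / t))) => //.
- exact: measurable_natr_RV.
- by rewrite ln_gt0// ltrDl.
- rewrite cond_poisson_expR_moment// lnK ?posrE ?addr_gt0//.
  by rewrite addrAC subrr add0r mulrCA mulfV ?gt_eqF// mulr1.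
Qed.

End conditional_poisson_process.

(** * The affine process at time zero and at positive times *)

Section affine_conditional_poisson.
Local Open Scope ereal_scope.
Context (R : realType) d (T : measurableType d) (P : probability T R).
Variables (lam : {RV P >-> R}) (X : R -> {RV P >-> nat}) (k : nat).
Hypothesis X_poisson : cond_poisson_process lam X.
Hypothesis k_gt0 : (0 < k)%N.

Lemma Zproc_at0 : {ae P, forall w, Zproc k X 0%R w = 1%R}.
Proof.
apply: filterS (cond_poisson_at0 X_poisson) => w X0.
by rewrite /Zproc/= /affine_count X0 mulr0 add0r.
Qed.

(** The values [0] and [1] of [X t] both have positive probability, so the constant
would be both [1] and [k + 1]. *)
Lemma Zproc_not_ae_cst (t c : R) : (0 < t)%R ->
  ~ {ae P, forall w, Zproc k X t w = c}.
Proof.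
move=> t0 Zc.
have Xn n : (k%:R * n%:R + 1 = c)%R.
  have [w <- <-] := ae_gt0_witness Zc (measurable_funPTI (X t) (Y := [set n]) I)
    (cond_poisson_marginal_gt0 X_poisson n t0).
  by [].
have /eqP := Xn 1%N; rewrite -(Xn 0%N) mulr0 mulr1 (inj_eq (addIr _)).
by rewrite pnatr_eq0 gtn_eqF.
Qed.

Lemma Zproc_Lfun2 (t : R) : (fun w => (X t w)%:R : R) \in Lfun P 2%:E ->
  (Zproc k X t : T -> R) \in Lfun P 2%:E.
Proof.
move=> X2; have -> : (Zproc k X t : T -> R) =
    ((k%:R \o* (fun w => (X t w)%:R)) \+ cst 1)%R.
  by apply/funext => w /=; rewrite mulrC.
rewrite rpredD//; first exact: lee1n.
  move=> ?; apply: Lfun_scale => //; exact: ler1n.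
by move=> ?; exact: Lfun_cst.
Qed.

(** [Z t - 1] is nonnegative, so it would vanish almost surely if its mean were
that of [Z 0 - 1], which is zero. *)
Lemma expectation_Zproc_neq (t : R) : (0 < t)%R ->
  (Zproc k X t : T -> R) \in Lfun P 2%:E ->
  'E_P[Zproc k X 0%R] <> 'E_P[Zproc k X t].
Proof.
move=> t0 Z2; rewrite (ae_eq_expectation (Y := cst 1%R) _ _ Zproc_at0)//.
rewrite expectation_cst => EZ.
have Z1 := Lfun_subset12 (fin_num_measure P _ measurableT) Z2.
apply: (@Zproc_not_ae_cst t 1%R) => //.
have ED : 'E_P[(Zproc k X t : T -> R) \- cst 1%R] = 0.
  by rewrite expectationB ?Lfun_cst// -EZ expectation_cst subee.
have mD : measurable_fun setT ((Zproc k X t : T -> R) \- cst 1%R)%R.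
  exact: measurable_funB.
have D0 w : (0 <= ((Zproc k X t : T -> R) \- cst 1) w)%R.
  by rewrite /= /affine_count addrK mulr_ge0.
apply: filterS (expectation_ge0_eq0 mD D0 ED) => w /eqP.
by rewrite subr_eq0 => /eqP.
Qed.

Lemma variance_Zproc_neq (t : R) : (0 < t)%R ->
  'V_P[Zproc k X 0%R] <> 'V_P[Zproc k X t].
Proof.
move=> t0; have E0 : 'E_P[Zproc k X 0%R] = 1.
  by rewrite (ae_eq_expectation (Y := cst 1%R) _ _ Zproc_at0)// expectation_cst.
have -> : 'V_P[Zproc k X 0%R] = 0.
  rewrite /variance covariance.unlock E0.
  rewrite (ae_eq_expectation (Y := cst 0%R)) ?expectation_cst//.
  by apply: filterS Zproc_at0 => w Zw;
  rewrite -[LHS]/((Zproc k X 0 w - 1) * (Zproc k X 0 w - 1))%R Zw subrr mulr0.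
by move=> /esym/(variance_eq0 (measurable_funPT _))/(Zproc_not_ae_cst t0).
Qed.

(** The singleton of [1] carries the whole law of [Z 0]. *)
Lemma distribution_Zproc_neq (t : R) : (0 < t)%R ->
  distribution P (Zproc k X 0%R) [set 1%R] <>
  distribution P (Zproc k X t) [set 1%R].
Proof.
move=> t0 Deq; apply: (@Zproc_not_ae_cst t 1%R) => //.
have mZ s : measurable (Zproc k X s @^-1` [set 1%R]).
  by apply: measurable_funPTI; exact: measurable_set1.
have PC s : P (~` (Zproc k X s @^-1` [set 1%R])) =
    1 - distribution P (Zproc k X s) [set 1%R].
  exact: probability_setC.
apply/negligibleP; first exact: measurableC (mZ t).
transitivity (1 - distribution P (Zproc k X t) [set 1%R]); first exact: PC.
rewrite -Deq -PC; apply: measure_negligible; first exact: measurableC.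
exact: Zproc_at0.
Qed.

Lemma fin_dim_distribution_Zproc1 (t : 1.-tuple R) :
  fin_dim_distribution (Zproc k X) t [set u | tnth u ord0 = 1%R] =
  distribution P (Zproc k X (tnth t ord0)) [set 1%R].
Proof.
by congr (P _); apply/seteqP; split => w /=; rewrite tnth_mktuple.
Qed.

End affine_conditional_poisson.

(** * The theorem *)

Theorem mainTheorem7 (R : realType) (d : measure_display)
    (T : measurableType d) (P : probability T R)
    (k : nat) (k_ge1 : (1 <= k)%N) (a : R) (a_gt0 : 0 < a)
    (lam : {RV P >-> R}) (lam_gamma : gamma_distributed k%:R^-1 a lam)
    (X : R -> {RV P >-> nat}) (X_poisson : cond_poisson_process lam X) :
  let Z := Zproc k X in
  [/\ (forall t : R, 0 <= t ->
         'E_P[Z t]%E \is a fin_num /\ 'V_P[Z t]%E \is a fin_num),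
      (exists s t : R, [/\ 0 <= s, 0 <= t & 'E_P[Z s]%E <> 'E_P[Z t]%E]),
      (exists s t : R, [/\ 0 <= s, 0 <= t & 'V_P[Z s]%E <> 'V_P[Z t]%E]),
      (exists s t : R, [/\ 0 <= s, 0 <= t &
         exists A : set R, measurable A /\
           distribution P (Z s) A <> distribution P (Z t) A]) &
      ~ stationary Z].
Proof.
move=> Z.
have s1 : k%:R^-1 <= 1 :> R by rewrite invf_le1 ?ltr0n// ler1n.
have Z2 t : 0 <= t -> (Z t : T -> R) \in Lfun P 2%:E.
  move=> t0; apply: Zproc_Lfun2.
  apply: (cond_poisson_Lfun2 X_poisson (gamma_ae_gt0 lam_gamma) _ t0
    (integral_expR_gamma_lty s1 a_gt0 lam_gamma)).
  by rewrite divr_gt0.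
split.
- move=> t t0; split; last exact/variance_fin_num/Z2.
  apply/expectation_fin_num/(Lfun_subset12 (fin_num_measure P _ measurableT)).
  exact: Z2.
- exists 0, 1; split => //.
  by apply: (expectation_Zproc_neq X_poisson) => //; exact: Z2.
- by exists 0, 1; split => //; apply: (variance_Zproc_neq X_poisson).
- exists 0, 1; split => //; exists [set 1]; split => //.
  by apply: (distribution_Zproc_neq X_poisson).
- move=> Zstat; apply: (distribution_Zproc_neq X_poisson k_ge1 ltr01).
  have /(_ _ ler01) := Zstat 1%N [tuple 0] 1 _.
  move=> /(_ _ [set u | tnth u ord0 = 1]).
  rewrite !fin_dim_distribution_Zproc1 tnth_mktuple add0r => -> //.
  + by move=> i; rewrite (tnth_nth 0) ord1.
  + rewrite -[X in measurable X]setTI.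
    exact: (@measurable_tnth _ R 1 ord0 measurableT _ (measurable_set1 1)).
Qed.
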